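(* For $k\in\mathbb{C}$ and $c\in[0,1)$ let $F_{\mathrm{even}}(k,c)=i\cos(kc\pi)+i\cos(k\pi)+2\sin(k\pi)$. Let $n\in\mathbb{Z}$ and, for $c\in[0,1)$, let $k_n=k_n(c)$ be the unique solution to $F_{\mathrm{even}}(k,c)=0$ with $k_n(c)\in\Pi^{\mathrm{even}}_n(c)$, where $$\Pi^{\mathrm{even}}_n(c)=\left\{x-iy:\ x,y\in\mathbb{R},\ |x-n|<\tfrac12,\ 0\le y\le\tfrac{\log 3}{\pi(1-|c|)}\right\}.$$ Then $\mathrm{Im}\,k_n(c)\to-\infty$ as $c\to1$.
   Context: For every $n\in\mathbb{Z}$ and $c\in[0,1)$ the rectangle $\Pi^{\mathrm{even}}_n(c)$ contains exactly one zero of $F_{\mathrm{even}}(\cdot,c)$. The zeros of $F_{\mathrm{even}}(\cdot,c)$ are called the even resonances of the quantum graph $\mathcal{G}(c)$: a circle of length $2\pi$ made of two edges of lengths $(1-c)\pi$ and $(1+c)\pi$ joining two vertices, with one infinite lead attached at each vertex. The limit $c\to1$ is taken through $c\in[0,1)$. *)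

(* Defs.v *)
From Stdlib Require Export Reals Lra ZArith.
From Coquelicot Require Export Coquelicot.
Open Scope R_scope.

(* Coquelicot's [C] comes without transcendental functions; these are the
   entire extensions of the real exp, cos and sin (see the lemmas below). *)
Definition Cexp (z : C) : C :=
  (exp (Re z) * cos (Im z), exp (Re z) * sin (Im z)).

Definition Ccos (z : C) : C :=
  ((Cexp (Ci * z) + Cexp (- (Ci * z))) / RtoC 2)%C.

Definition Csin (z : C) : C :=
  ((Cexp (Ci * z) - Cexp (- (Ci * z))) / (RtoC 2 * Ci))%C.

Lemma Cexp_plus (z w : C) : Cexp (z + w) = (Cexp z * Cexp w)%C.
Proof.
destruct z as [a b]; destruct w as [c d].
unfold Cexp, Cplus, Cmult; simpl.
rewrite exp_plus, cos_plus, sin_plus.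
f_equal; ring.
Qed.

Lemma Cexp_RtoC (x : R) : Cexp (RtoC x) = RtoC (exp x).
Proof.
unfold Cexp, RtoC; simpl. rewrite cos_0, sin_0. f_equal; ring.
Qed.

Lemma Cexp_Ci (x : R) : Cexp (Ci * RtoC x) = (cos x, sin x).
Proof.
unfold Cexp, Cmult, Ci, RtoC; simpl.
replace (0 * x - 1 * 0) with 0 by ring.
replace (0 * 0 + 1 * x) with x by ring.
rewrite exp_0. f_equal; ring.
Qed.

Lemma Cexp_opp_Ci (x : R) : Cexp (- (Ci * RtoC x)) = (cos x, - sin x).
Proof.
replace (- (Ci * RtoC x))%C with (Ci * RtoC (- x))%C.
- now rewrite Cexp_Ci, cos_neg, sin_neg.
- rewrite RtoC_opp. ring.
Qed.

Lemma Ccos_RtoC (x : R) : Ccos (RtoC x) = RtoC (cos x).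
Proof.
unfold Ccos. rewrite Cexp_Ci, Cexp_opp_Ci.
unfold Cdiv, Cinv, Cplus, Cmult, RtoC; simpl. f_equal; field.
Qed.

Lemma Csin_RtoC (x : R) : Csin (RtoC x) = RtoC (sin x).
Proof.
unfold Csin. rewrite Cexp_Ci, Cexp_opp_Ci.
unfold Cdiv, Cinv, Cminus, Copp, Cplus, Cmult, Ci, RtoC; simpl.
f_equal; field.
Qed.

Definition F_even (k : C) (c : R) : C :=
  (Ci * Ccos (k * RtoC c * RtoC PI) + Ci * Ccos (k * RtoC PI)
   + RtoC 2 * Csin (k * RtoC PI))%C.

Definition Pi_even (n : Z) (c : R) (z : C) : Prop :=
  exists x y : R,
    z = (RtoC x - Ci * RtoC y)%C /\
    Rabs (x - IZR n) < 1 / 2 /\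
    0 <= y <= ln 3 / (PI * (1 - Rabs c)).

(* Main.v *)
Require Import Defs.
Open Scope R_scope.

(** Put [w = i k pi] and [d = 1 - c].  Multiplying [F_even k c] by [2 exp w]
    turns the equation [F_even k c = 0] into
      [4 = exp (2 w) (1 - exp (- d w)) + (1 - exp (d w))].
    At [d = 0] the right-hand side vanishes: the limiting graph has no even
    resonance at all, so a resonance that persists for [c < 1] has to escape.
    Quantitatively, since [|exp u - 1| <= exp (|Re u| + |Im u|) - 1], a zero [k]
    satisfies
      [4 <= (exp (- 2 pi Im k) + 1) (exp (|1 - c| pi (|Re k| + |Im k|)) - 1)]
    ([F_even_zero_bound]).  In the rectangle around [n] the real part of [k] is
    bounded and [Im k <= 0], so a lower bound on [Im k] would keep [k] in a
    fixed compact set, where the right-hand side tends to [0] as [c] tends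
    to [1]. *)

Lemma exp_le_compat (x y : R) : x <= y -> exp x <= exp y.
Proof.
intros [H| ->]; [now apply Rlt_le, exp_increasing | apply Rle_refl].
Qed.

(** For negative [a] this is [2 <= exp a + exp (- a)]. *)
Lemma Rabs_exp_minus_1 (a : R) : Rabs (exp a - 1) <= exp (Rabs a) - 1.
Proof.
pose proof (exp_pos a) as Ha.
destruct (Rle_or_lt 0 a) as [H|H].
- rewrite (Rabs_pos_eq a) by lra.
  pose proof (exp_ineq1_le a). rewrite Rabs_pos_eq; lra.
- rewrite (Rabs_left a) by lra.
  pose proof (exp_ineq1_le (- a)) as H1.
  assert (H2 : exp a * exp (- a) = 1).
  { rewrite <- exp_plus, Rplus_opp_r. apply exp_0. }
  apply Rabs_le. split; nra.
Qed.

(** A chord of the unit circle is at most as long as its arc: the chord is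
    [2 |sin (b / 2)|]. *)
Lemma Cmod_unit_circle_minus_1 (b : R) :
  Cmod ((cos b, sin b) - RtoC 1)%C <= Rabs b.
Proof.
rewrite <- (sqrt_Rsqr_abs b). unfold Cmod. apply sqrt_le_1_alt. simpl.
assert (Hs : Rsqr (sin (b / 2)) <= Rsqr (b / 2)).
{ apply Rsqr_le_abs_1.
  assert (Hpos : forall x, 0 <= x -> Rabs (sin x) <= x).
  { intros x [Hx|<-].
    - pose proof (sin_lt_x x Hx).
      destruct (Rle_or_lt 1 x) as [H1|H1].
      + apply Rle_trans with 1; [|lra].
        apply Rabs_le. pose proof (SIN_bound x). lra.
      + rewrite Rabs_pos_eq; [lra|].
        apply sin_ge_0; pose proof PI2_1; lra.
    - rewrite sin_0, Rabs_R0. lra. }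
  destruct (Rle_or_lt 0 (b / 2)) as [H|H].
  - rewrite (Rabs_pos_eq (b / 2)) by lra. now apply Hpos.
  - rewrite (Rabs_left (b / 2)) by lra.
    rewrite <- Rabs_Ropp, <- sin_neg. apply Hpos. lra. }
assert (Hc : cos b = 1 - 2 * sin (b / 2) * sin (b / 2)).
{ rewrite <- cos_2a_sin. f_equal. field. }
pose proof (sin2_cos2 b) as H1. unfold Rsqr in *.
nra.
Qed.

Lemma Cmod_Cexp (z : C) : Cmod (Cexp z) = exp (Re z).
Proof.
unfold Cmod, Cexp; simpl.
replace (_ + _) with (Rsqr (exp (Re z)) * (Rsqr (sin (Im z)) + Rsqr (cos (Im z))))
  by (unfold Rsqr; ring).
rewrite sin2_cos2, Rmult_1_r.
apply sqrt_Rsqr. apply Rlt_le, exp_pos.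
Qed.

(** Writing [u = a + i b], go from [1] to [exp u] through [exp (i b)]:
    the two legs are at most [|b|] and [exp |a| - 1]. *)
Lemma Cmod_Cexp_minus_1 (u : C) :
  Cmod (Cexp u - RtoC 1)%C <= exp (Rabs (Re u) + Rabs (Im u)) - 1.
Proof.
destruct u as [a b]; cbn [Re Im fst snd].
set (e := (cos b, sin b) : C).
assert (He : Cmod e = 1).
{ unfold e. rewrite <- Cexp_Ci, Cmod_Cexp. simpl.
  replace (0 * b - 1 * 0) with 0 by ring. apply exp_0. }
replace (Cexp (a, b) - RtoC 1)%C
  with (RtoC (exp a - 1) * e + (e - RtoC 1))%C.
2:{ unfold Cexp, e, Cminus, Copp, Cplus, Cmult, RtoC; simpl. f_equal; ring. }
eapply Rle_trans; [apply Cmod_triangle|].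
rewrite Cmod_mult, He, Cmod_R, exp_plus.
pose proof (Rabs_exp_minus_1 a) as Ha.
pose proof (Cmod_unit_circle_minus_1 b) as Hb. fold e in Hb.
pose proof (exp_ineq1_le (Rabs a)). pose proof (exp_ineq1_le (Rabs b)).
pose proof (Rabs_pos a). pose proof (Rabs_pos b).
nra.
Qed.

Lemma Cexp_opp_r (z : C) : (Cexp z * Cexp (- z) = RtoC 1)%C.
Proof.
rewrite <- Cexp_plus, Cplus_opp_r, Cexp_RtoC. now rewrite exp_0.
Qed.

(** The factor [2 exp w] makes the part of [F_even] that survives at [c = 1],
    namely [2 i exp (- w)], constant; everything else carries a factor that
    vanishes at [c = 1]. *)
Lemma F_even_normalized (k : C) (c : R) :
  let w := (Ci * (k * RtoC PI))%C in
  let v := (RtoC (1 - c) * w)%C in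
  (RtoC 2 * Cexp w * F_even k c
   = Ci * (RtoC 4 + (Cexp w * Cexp w * (Cexp (- v) - RtoC 1)
                     + (Cexp v - RtoC 1))))%C.
Proof.
intros w v.
unfold F_even, Ccos, Csin. fold w.
replace (Ci * (k * RtoC c * RtoC PI))%C with (w + - v)%C.
2:{ unfold v, w. rewrite RtoC_minus. ring. }
replace (- (w + - v))%C with (- w + v)%C by ring.
rewrite !Cexp_plus.
pose proof (Cexp_opp_r w) as H.
set (p := Cexp w) in *. set (q := Cexp (- w)) in *.
set (r := Cexp v). set (s := Cexp (- v)).
assert (HCi : (/ (RtoC 2 * Ci) = - (Ci * / RtoC 2))%C)
  by (unfold Cinv, Copp, Cmult, Ci, RtoC; simpl; f_equal; field).
unfold Cdiv. rewrite HCi.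
transitivity (Ci * (p * p * s + (p * q) * r - p * p + RtoC 3 * (p * q)))%C.
- field.
- rewrite H. ring.
Qed.

(** Take moduli in the identity above: [|exp w|] is [exp (- pi Im k)], and the
    two vanishing factors obey the same bound, which is even in [v]. *)
Lemma F_even_zero_bound (k : C) (c : R) :
  F_even k c = RtoC 0 ->
  4 <= (exp (- 2 * PI * Im k) + 1)
       * (exp (Rabs (1 - c) * PI * (Rabs (Re k) + Rabs (Im k))) - 1).
Proof.
intros HF.
pose proof (F_even_normalized k c) as H. cbv zeta in H. rewrite HF in H.
set (w := (Ci * (k * RtoC PI))%C) in H.
set (v := (RtoC (1 - c) * w)%C) in H.
set (g := exp _ - 1).
assert (Hw : Re w = - PI * Im k /\ Im w = PI * Re k).
{ destruct k as [x y]; unfold w, Ci, RtoC, Cmult; simpl. split; ring. }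
assert (Hv : Rabs (Re v) + Rabs (Im v)
             = Rabs (1 - c) * PI * (Rabs (Re k) + Rabs (Im k))).
{ replace (Re v) with ((1 - c) * Re w) by (unfold v, RtoC, Cmult; simpl; ring).
  replace (Im v) with ((1 - c) * Im w) by (unfold v, RtoC, Cmult; simpl; ring).
  destruct Hw as [-> ->]. rewrite !Rabs_mult, Rabs_Ropp.
  rewrite (Rabs_pos_eq PI) by (pose proof PI_RGT_0; lra). ring. }
assert (Hp : Cmod (Cexp v - RtoC 1)%C <= g).
{ unfold g. rewrite <- Hv. apply Cmod_Cexp_minus_1. }
assert (Hm : Cmod (Cexp (- v) - RtoC 1)%C <= g).
{ unfold g. rewrite <- Hv, <- (Rabs_Ropp (Re v)), <- (Rabs_Ropp (Im v)).
  apply Cmod_Cexp_minus_1. }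
set (S := (Cexp w * Cexp w * (Cexp (- v) - RtoC 1) + (Cexp v - RtoC 1))%C) in H.
assert (HS : Cmod S = 4).
{ assert (HS : (RtoC 4 + S)%C = RtoC 0).
  { destruct S as [a b]. unfold Ci, Cplus, Cmult, RtoC in *; simpl in *.
    injection H; intros. f_equal; lra. }
  replace S with (- RtoC 4 + (RtoC 4 + S))%C by ring.
  rewrite HS, Cplus_0_r, Cmod_opp, Cmod_R. apply Rabs_pos_eq. lra. }
rewrite <- HS. unfold S.
eapply Rle_trans; [apply Cmod_triangle|].
rewrite !Cmod_mult, Cmod_Cexp, <- exp_plus.
destruct Hw as [-> _].
replace (- PI * Im k + - PI * Im k) with (- 2 * PI * Im k) by ring.
pose proof (exp_pos (- 2 * PI * Im k)).
nra.
Qed.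

(** With [A], [B] bounding the two factors on a compact set of [k], this is why
    [F_even_zero_bound] fails there for [c] close to [1]. *)
Lemma bound_vanishes (A B : R) :
  locally 1 (fun c : R => A * (exp (Rabs (1 - c) * B) - 1) < 4).
Proof.
assert (Hc : continuous (fun c : R => A * (exp (Rabs (1 - c) * B) - 1)) 1).
{ apply (continuous_scal_r A (fun c : R => exp (Rabs (1 - c) * B) - 1)).
  apply (continuous_minus (fun c : R => exp (Rabs (1 - c) * B)) (fun _ => 1));
    [|apply continuous_const].
  apply continuous_exp_comp.
  apply (continuous_scal_l (fun c : R => Rabs (1 - c)) B).
  apply continuous_Rabs_comp.
  apply (continuous_minus (fun _ : R => 1) (fun c => c));
    [apply continuous_const|apply continuous_id]. }
apply (Hc (fun y => y < 4)). apply (open_lt 4).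
replace (Rabs (1 - 1)) with 0 by (rewrite Rminus_diag, Rabs_R0; reflexivity).
rewrite Rmult_0_l, exp_0. lra.
Qed.

Theorem theorem6p6 (n : Z) (k : R -> C)
  (hk : forall c : R, 0 <= c < 1 ->
     unique (fun z : C => Pi_even n c z /\ F_even z c = RtoC 0) (k c)) :
  filterlim (fun c : R => Im (k c))
    (within (fun c : R => 0 <= c < 1) (locally 1))
    (Rbar_locally m_infty).
Proof.
intros P [M HM]. unfold filtermap, within.
(* [A] and [B] bound the two factors of [F_even_zero_bound] over the zeros in
   the rectangle with [M <= Im k]. *)
set (A := exp (2 * PI * Rabs M) + 1).
set (B := PI * (Rabs (IZR n) + 1 / 2 + Rabs M)).
generalize (bound_vanishes A B). apply filter_imp. intros c Hc Hc01.
apply HM. apply Rnot_le_lt. intros HMk.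
destruct (hk c Hc01) as [[(x & y & Hxy & Hx & Hy & _) HF] _].
pose proof (F_even_zero_bound _ _ HF) as Hb.
assert (HRe : Re (k c) = x) by (rewrite Hxy; unfold Ci, RtoC; simpl; ring).
assert (HIm : Im (k c) = - y) by (rewrite Hxy; unfold Ci, RtoC; simpl; ring).
rewrite HRe, HIm in *.
pose proof PI_RGT_0 as HPI.
pose proof (Rabs_pos (1 - c)) as Hd.
assert (HyM : y <= Rabs M) by (pose proof (Rle_abs (- M)); rewrite Rabs_Ropp in *; lra).
assert (HxR : Rabs x <= Rabs (IZR n) + 1 / 2).
{ replace x with (IZR n + (x - IZR n)) by ring.
  pose proof (Rabs_triang (IZR n) (x - IZR n)). lra. }
assert (HA : exp (- 2 * PI * - y) + 1 <= A).
{ unfold A. apply Rplus_le_compat_r, exp_le_compat. nra. }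
assert (HB : exp (Rabs (1 - c) * PI * (Rabs x + Rabs (- y))) <= exp (Rabs (1 - c) * B)).
{ apply exp_le_compat. unfold B. rewrite Rmult_assoc.
  rewrite (Rabs_Ropp y), (Rabs_pos_eq y) by lra.
  apply Rmult_le_compat_l; [lra|]. apply Rmult_le_compat_l; lra. }
pose proof (exp_pos (- 2 * PI * - y)).
assert (Hg : 0 <= Rabs (1 - c) * PI * (Rabs x + Rabs (- y))).
{ pose proof (Rabs_pos x). pose proof (Rabs_pos (- y)).
  apply Rmult_le_pos; [apply Rmult_le_pos|]; lra. }
pose proof (exp_ineq1_le (Rabs (1 - c) * PI * (Rabs x + Rabs (- y)))).
apply (Rlt_irrefl 4).
eapply Rle_lt_trans; [exact Hb|]. eapply Rle_lt_trans; [|exact Hc].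
apply Rmult_le_compat; lra.
Qed.
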